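(* Let $Q$ be a basic sequence that is infinite in limit, and let $\zeta_1$, $R_1$ be the real number and basic sequence defined in the context. Then $$\psi_{R_1,Q}(\zeta_1)\in\mathscr{RN}^{I}(Q)\cap\mathscr{RN}^{II}(Q)\subseteq\mathscr{RN}(Q).$$ If $Q$ is a computable sequence, then $\psi_{R_1,Q}(\zeta_1)$ is a computable real number.
   Context: A block is a finite tuple of non-negative integers; a block in base $b$ has entries in $\{0,\dots,b-1\}$. A real number is computable if there is an algorithm that approximates it to any prescribed precision. Definition of $\zeta_1,R_1$. $C_{b,w}$ is the block obtained by concatenating all blocks of length $w$ in base $b$ in lexicographic order. Put $l_i=0$, $X_i=(0)$ for $1\le i<6$, and for $i\ge6$: $X_i=C_{i,\,i!}$, $b_i=i$, $l_i=3^{i!}(i+1)^{i!\cdot i}$. Let $L_0=0$, $L_i=l_1|X_1|+\dots+l_i|X_i|$. $R_1=(\gamma_n)_{n\ge1}$ with $\gamma_n=b_i$ for $L_{i-1}<n\le L_i$; $\zeta_1=\sum_{n\ge1}\frac{E_n}{\gamma_1\cdots\gamma_n}$ where $(E_1,E_2,\dots)=X_1^{l_1}X_2^{l_2}X_3^{l_3}\cdots$ ($X_i$ repeated $l_i$ times, concatenated). A basic sequence is a sequence $Q=(q_n)_{n\ge1}$ of integers $q_n\ge2$; it is infinite in limit if $q_n\to\infty$. Each real $x$ has a unique $Q$-Cantor series expansion $x=E_0+\sum_{n\ge1}\frac{E_n}{q_1\cdots q_n}$ with $E_0=\lfloor x\rfloor$, $E_n\in\{0,\dots,q_n-1\}$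 and $E_n\ne q_n-1$ infinitely often; write $x=E_0.E_1E_2\dots$ w.r.t. $Q$. For $x=E_0.E_1E_2\dots$ w.r.t. $P$, $\psi_{P,Q}(x)=\sum_{n\ge1}\frac{\min(E_n,q_n-1)}{q_1\cdots q_n}$. For a block $B$ of length $k$, $N_n^Q(B,x)$ is the number of $p$ with $1\le p\le n$ and $(E_p,\dots,E_{p+k-1})=B$; for $m\ge1$, $0\le r\le m-1$, $N^Q_{n,m,r}(B,x)$ counts only those $p$ with $p\equiv r\pmod m$. $\mathscr{RN}_k(Q)$ is the set of real $x$ with $\lim_n N_n^Q(B_1,x)/N_n^Q(B_2,x)=1$ for all blocks $B_1,B_2$ of length $k$; $\mathscr{RN}(Q)=\bigcap_{k\ge1}\mathscr{RN}_k(Q)$. $\mathscr{RN}^I_{k,m,r}(Q)$ is the set of real $x$ with $\lim_n N^Q_{n,m,r}(B_1,x)/N^Q_{n,m,r}(B_2,x)=1$ for all blocks $B_1,B_2$ of length $k$; $\mathscr{RN}^I(Q)=\bigcap_{k\ge1}\bigcap_{m=1}^k\bigcap_{r=0}^{m-1}\mathscr{RN}^I_{k,m,r}(Q)$. Let $p_1<p_2<\cdots$ be the positive integers congruent to $r$ mod $m$; put $\Lambda_{m,r}(Q)=(q_{p_1},q_{p_2},\dots)$ and $\Upsilon_{Q,m,r}(x)=0.E_{p_1}E_{p_2}\dots$ w.r.t. $\Lambda_{m,r}(Q)$. $\mathscr{RN}^{II}_{k,m,r}(Q)=\{x:\Upsilon_{Q,m,r}(x)\in\mathscr{RN}_k(\Lambda_{m,r}(Q))\}$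 and $\mathscr{RN}^{II}(Q)=\bigcap_{k\ge1}\bigcap_{m\ge1}\bigcap_{r=0}^{m-1}\mathscr{RN}^{II}_{k,m,r}(Q)$. *)

(* Defs.v *)
From HB Require Import structures.
From mathcomp Require Import all_boot all_order all_algebra.
From mathcomp Require Import all_classical all_reals all_analysis.
Set Implicit Arguments.
Unset Strict Implicit.
Unset Printing Implicit Defensive.
Import Order.TTheory GRing.Theory Num.Theory.
Import numFieldNormedType.Exports.

Local Open Scope classical_set_scope.
Local Open Scope ring_scope.

(* Sequences (q_n), (E_n), ... indexed by n >= 1 are functions nat -> nat; the
   value at 0 is junk and is never used. *)

Definition basic_sequence (Q : nat -> nat) : Prop :=
  forall n, (1 <= n)%N -> (2 <= Q n)%N.

Definition infinite_in_limit (Q : nat -> nat) : Prop := Q @ \oo --> \oo.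

Section CantorSeries.
Variable R : realType.
Implicit Types (P Q E : nat -> nat) (x : R) (B : seq nat) (k m r n : nat).

Definition cantor_sum Q E : R :=
  limn (fun N => \sum_(1 <= n < N.+1)
                   (E n)%:R / \prod_(1 <= j < n.+1) (Q j)%:R : R).

Definition cantor_expansion Q x E : Prop :=
  [/\ x = (Num.floor x)%:~R + cantor_sum Q E,
      forall n, (1 <= n)%N -> (E n < Q n)%N
    & forall N, exists2 n, (N < n)%N & E n <> (Q n).-1].

(* E_1, E_2, ... for the Q-Cantor series expansion of x; meaningful when Q is a
   basic sequence, in which case the E_n with n >= 1 exist and are unique. *)
Definition digit Q x : nat -> nat :=
  xget (fun=> 0%N) [set E | cantor_expansion Q x E].

Definition psi P Q x : R :=
  cantor_sum Q (fun n => minn (digit P x n) (Q n).-1).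

Definition occurs Q B x p : bool :=
  [seq digit Q x j | j <- iota p (size B)] == B.

Definition Nocc Q B x n : nat := count (occurs Q B x) (iota 1 n).

Definition Nocc_mod Q m r B x n : nat :=
  count (fun p => (p == r %[mod m]) && occurs Q B x p) (iota 1 n).

(* A block is any seq nat: its entries are not bounded by a base. *)
Definition RNk Q k : set R :=
  [set x | forall B1 B2 : seq nat, size B1 = k -> size B2 = k ->
     (Nocc Q B1 x n)%:R / (Nocc Q B2 x n)%:R @[n --> \oo] --> (1 : R)].

Definition RN Q : set R := \bigcap_(k in [set k | (1 <= k)%N]) RNk Q k.

Definition RNIk Q k m r : set R :=
  [set x | forall B1 B2 : seq nat, size B1 = k -> size B2 = k ->
     (Nocc_mod Q m r B1 x n)%:R / (Nocc_mod Q m r B2 x n)%:R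
       @[n --> \oo] --> (1 : R)].

Definition RNI Q : set R :=
  \bigcap_(k in [set k | (1 <= k)%N])
    \bigcap_(m in [set m | (1 <= m <= k)%N])
      \bigcap_(r in [set r | (r < m)%N]) RNIk Q k m r.

(* For 0 <= r < m and j >= 1, the j-th positive integer congruent to r mod m. *)
Definition prog m r j : nat :=
  if r == 0%N then (m * j)%N else (r + m * j.-1)%N.

Definition Lambda m r Q : nat -> nat := fun j => Q (prog m r j).

Definition Upsilon Q m r x : R :=
  cantor_sum (Lambda m r Q) (fun j => digit Q x (prog m r j)).

Definition RNIIk Q k m r : set R :=
  [set x | RNk (Lambda m r Q) k (Upsilon Q m r x)].

Definition RNII Q : set R :=
  \bigcap_(k in [set k | (1 <= k)%N])
    \bigcap_(m in [set m | (1 <= m)%N])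
      \bigcap_(r in [set r | (r < m)%N]) RNIIk Q k m r.

End CantorSeries.

Section Zeta1.
Local Open Scope nat_scope.

(* The blocks of length w in base b, in lexicographic order. *)
Fixpoint base_blocks (b w : nat) : seq (seq nat) :=
  if w is w'.+1 then [seq a :: s | a <- iota 0 b, s <- base_blocks b w']
  else [:: [::]].

Definition Cblock (b w : nat) : seq nat := flatten (base_blocks b w).

Definition X1 (i : nat) : seq nat := if i < 6 then [:: 0] else Cblock i i`!.

(* b_i is not specified for i < 6, and is not used there. *)
Definition b1 (i : nat) : nat := i.

Definition l1 (i : nat) : nat :=
  if i < 6 then 0 else 3 ^ i`! * i.+1 ^ (i`! * i).

Definition L1 (i : nat) : nat := \sum_(1 <= j < i.+1) l1 j * size (X1 j).

Lemma size_Cblock (b w : nat) : size (Cblock b w) = w * b ^ w.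
Proof.
rewrite /Cblock; have -> : w * b ^ w = w * size (base_blocks b w).
  congr (_ * _); elim: w => [|w IHw] //=.
  by rewrite size_allpairs size_iota -IHw expnS.
have : all (fun s => size s == w) (base_blocks b w).
  elim: w => [|w /allP IHw] //=.
  by apply/allP => _ /allpairsP[[a s] /= [_ /IHw/eqP <- ->]].
elim: (base_blocks b w) => [|s ss IHs] /=; first by rewrite muln0.
by move=> /andP[/eqP ss_w /IHs ssE]; rewrite size_cat ss_w ssE mulnS.
Qed.

Lemma L1_unbounded (n : nat) : exists i, n <= L1 i.
Proof.
have pos i : 6 <= i -> 0 < l1 i * size (X1 i).
  rewrite leqNgt /l1 /X1 => /negbTE ge6; rewrite ge6 size_Cblock.
  by case: i ge6 => // i _; rewrite !muln_gt0 !expn_gt0 fact_gt0.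
exists (n + 5); elim: n => [//|n IHn].
rewrite addSn /L1 big_nat_recr //=.
apply: leq_trans (leq_add IHn (pos (n + 5).+1 _)); first by rewrite addn1.
by rewrite -addnS leq_addl.
Qed.

(* The index i with L_{i-1} < n <= L_i, for n >= 1. *)
Definition level1 (n : nat) : nat := ex_minn (L1_unbounded n).

Definition R1 (n : nat) : nat := b1 (level1 n).

(* The n-th entry (n >= 1) of X_1^{l_1} X_2^{l_2} X_3^{l_3} ..., read in the
   prefix X_1^{l_1} ... X_i^{l_i} of length L_i >= n. *)
Definition E1 (n : nat) : nat :=
  nth 0 (flatten [seq flatten (nseq (l1 j) (X1 j)) | j <- iota 1 (level1 n)])
      n.-1.

End Zeta1.

Definition zeta1 (R : realType) : R := cantor_sum R R1 E1.

(* Kleene's total general recursive functions: the least class of functions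
   containing zero, successor and projections, closed under composition,
   primitive recursion, and minimization of regular functions. *)
Inductive recursive : forall n : nat, (n.-tuple nat -> nat) -> Prop :=
| rec_zero n : recursive (fun _ : n.-tuple nat => 0%N)
| rec_succ : recursive (fun v : 1.-tuple nat => (thead v).+1)
| rec_proj n (i : 'I_n) : recursive (fun v : n.-tuple nat => tnth v i)
| rec_comp m n (f : m.-tuple nat -> nat) (g : 'I_m -> n.-tuple nat -> nat) :
    recursive f -> (forall i, recursive (g i)) ->
    recursive (fun v : n.-tuple nat => f [tuple g i v | i < m])
| rec_prim n (f : n.-tuple nat -> nat) (g : n.+2.-tuple nat -> nat)
    (h : n.+1.-tuple nat -> nat) :
    recursive f -> recursive g ->
    (forall v : n.-tuple nat, h [tuple of 0%N :: v] = f v) ->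
    (forall y (v : n.-tuple nat),
       h [tuple of y.+1 :: v] =
       g [tuple of y :: h [tuple of y :: v] :: v]) ->
    recursive h
| rec_mu n (f : n.+1.-tuple nat -> nat) (h : n.-tuple nat -> nat) :
    recursive f ->
    (forall v : n.-tuple nat, f [tuple of h v :: v] = 0%N) ->
    (forall (v : n.-tuple nat) y,
       (y < h v)%N -> f [tuple of y :: v] <> 0%N) ->
    recursive h.

Definition computable_sequence (u : nat -> nat) : Prop :=
  recursive (fun v : 1.-tuple nat => u (thead v)).

(* An algorithm maps n to a rational number (a n - b n) / (c n + 1) that
   approximates x to within 2^-n. *)
Definition computable_real (R : realType) (x : R) : Prop :=
  exists a b c : nat -> nat,
    [/\ computable_sequence a, computable_sequence b, computable_sequence c
      & forall n, `|x - ((a n)%:R - (b n)%:R) / (c n).+1%:R| <= 2 ^- n].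

(* Main.v *)
Require Import Defs.
From mathcomp Require Import all_boot all_order all_algebra.
From mathcomp Require Import all_classical all_reals all_analysis.
From mathcomp Require Import zify.

(** Let [E] be the sequence of digits of zeta1 and [F n = minn (E n) (Q n).-1]
    the digits of its image under psi.

    Everything reduces to [E].  As [Q] tends to infinity, a fixed block has all
    its entries below [(Q n).-1] from some point on; there [F] and [E] take a
    given entry of the block at the same places.  So the counts for [F] and for
    [E] differ by a bounded amount, and it suffices that in [E] any two blocks
    of the same length occur infinitely often with asymptotically equal counts.
    The two kinds of relative normality are treated at once by counting the [p]
    in a fixed residue class mod [m] at which a block is read with a stride [s]:
    the entries at [p], [p + s], [p + 2 s] and so on.  For RNI the stride is 1,
    for RNII it is [m] ([count_prog]), and RN is the case [m = 1] of RNI.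

    Inside one copy of [X_i], all words of length [w = i!] over [i] letters
    follow each other, and [m] divides [w] once [i >= m].  So a place [c] in the
    word determines the residue mod [m], and if the block read from [c] on stays
    inside the word, exactly [i ^ (w - k)] words carry it at [c]
    ([column_inner]): the number is the same for all blocks of length [k] with
    letters below [i].  Only the [s * k] last places of each word, where the
    block may overlap the next word, can tell two blocks apart; their share of
    the total is of order [i ^ k / i!], which tends to 0 ([copy_balanced]).  An
    incomplete copy of [X_(i+1)] does no harm, since the [l_i] copies of [X_i]
    before it contain every block far more often than [X_(i+1)] has entries
    ([next_copy_negligible]): this uses that [(3 i) ^ i!] beats
    [(i + 1) ^ i!] by the factor [2 ^ i!].  Summation over the copies gives
    [frequency], in the form [K * C1 n <= K.+1 * C2 n] for all [K] and all large
    [n], so no real number enters before [ratio_cvg1].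

    To pass between a real number and its digits, clear denominators in the
    partial sums of a Cantor series: the numerator is the integer part of the
    number times the denominator ([numer_floor]), hence the digits are unique.
    These numerators and denominators also compute the number: the tail after
    [n] terms is at most [1 / (q_1 ... q_n) <= 2 ^- n], and [E] is given by an
    arithmetic formula ([E1_formula]) built from recursive functions. *)

Set Implicit Arguments.
Unset Strict Implicit.
Unset Printing Implicit Defensive.

Section Combinatorics.
Local Open Scope nat_scope.

(** * Counting the words that carry a block *)

Lemma nth_flatten_uniform (T : Type) (x0 : T) (ss : seq (seq T)) w u c :
  all (fun s => size s == w) ss -> c < w ->
  nth x0 (flatten ss) (u * w + c) = nth x0 (nth [::] ss u) c.
Proof.
move=> + c_lt; elim: ss u => [|s ss IHss] u /=; first by rewrite !nth_nil.
move=> /andP[/eqP s_w /IHss IH]; rewrite nth_cat s_w.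
case: u => [|u] /=; first by rewrite c_lt.
by rewrite mulSn -addnA ltnNge leq_addr /= addKn IH.
Qed.

Lemma size_base_blocks b w : size (base_blocks b w) = b ^ w.
Proof. by elim: w => [|w IHw] //=; rewrite size_allpairs size_iota IHw expnS. Qed.

Lemma all_size_base_blocks b w : all (fun s => size s == w) (base_blocks b w).
Proof.
elim: w => [|w /allP IHw] //=.
by apply/allP => _ /allpairsP[[a s] /= [_ /IHw/eqP <- ->]].
Qed.

(** Lexicographic order makes the word of rank [u] the base-[b] expansion of
    [u], most significant digit first. *)
Lemma nth_base_blocks b w u c : u < b ^ w -> c < w ->
  nth 0 (nth [::] (base_blocks b w) u) c = u %/ b ^ (w.-1 - c) %% b.
Proof.
elim: w u c => [|w IHw] //= u c u_lt c_lt.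
have bw_gt0 : 0 < b ^ w.
  by case: (posnP (b ^ w)) u_lt => // e0; rewrite expnS e0 muln0.
have u_q : u %/ b ^ w < b by rewrite ltn_divLR // -expnS.
have u_r : u %% b ^ w < b ^ w by rewrite ltn_mod.
rewrite {1}(divn_eq u (b ^ w)) nth_flatten_uniform //; last first.
  apply/allP => _ /mapP[a _ ->]; by rewrite size_map size_base_blocks.
rewrite (nth_map 0) ?size_iota // (nth_map [::]) ?size_base_blocks // nth_iota //.
case: c c_lt => [|c] c_lt /=; first by rewrite subn0 modn_small.
rewrite IHw //; have -> : w - c.+1 = w.-1 - c by lia.
rewrite !modn_divl modn_dvdm // -expnS dvdn_exp2l //; lia.
Qed.

Lemma count_allpairs_cons (Q : pred (seq nat)) (g : pred nat)
    (h : pred (seq nat)) A S : (forall a s, Q (a :: s) = g a && h s) ->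
  count Q [seq a :: s | a <- A, s <- S] = count g A * count h S.
Proof.
move=> QE; elim: A => //= a A IHA; rewrite count_cat IHA count_map mulnDl.
congr (_ + _); rewrite (eq_count (a2 := fun s => g a && h s)); last first.
  by move=> s; rewrite /= QE.
by case: (g a) => /=; rewrite ?mul1n ?mul0n ?count_pred0.
Qed.

(** The letters of a word are chosen independently. *)
Lemma count_base_blocks b w (f : nat -> pred nat) :
  count (fun s => all (fun c => f c (nth 0 s c)) (iota 0 w)) (base_blocks b w)
  = \prod_(c < w) count (f c) (iota 0 b).
Proof.
elim: w f => [|w IHw] f; first by rewrite big_ord0.
rewrite big_ord_recl /= -(IHw (fun c => f c.+1)).
apply: count_allpairs_cons => a s /=; congr (_ && _).
by rewrite -[1]addn0 iotaDl all_map; apply: eq_all.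
Qed.

Lemma count_iota (P : pred nat) a n :
  count P (iota a n) = \sum_(j < n) P (a + j).
Proof.
elim: n => [|n IHn]; first by rewrite big_ord0.
by rewrite -addn1 iotaD count_cat IHn /= addn0 addn1 big_ord_recr.
Qed.

Lemma sum_ord_mul (f : nat -> nat) N w :
  \sum_(j < N * w) f j = \sum_(u < N) \sum_(c < w) f (u * w + c).
Proof.
elim: N => [|N IHN]; first by rewrite !big_ord0.
rewrite big_ord_recr -IHN mulSnr big_split_ord; congr (_ + _).
Qed.

Definition pattern (s : nat) (E : nat -> nat) (B : seq nat) (p : nat) : bool :=
  all (fun t => E (p + s * t) == nth 0 B t) (iota 0 (size B)).

Definition slots (s k c : nat) : seq nat := [seq c + s * t | t <- iota 0 k].

(** One factor for each place in a word: the letter is forced at the slots and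
    free elsewhere. *)
Definition nwords (b w s k c : nat) : nat :=
  \prod_(i < w) (if nat_of_ord i \in slots s k c then 1 else b).

Lemma count_pattern_words b w s B c : 0 < s -> {in B, forall a, a < b} ->
  c + s * size B <= w ->
  count (fun v => pattern s (nth 0 v) B c) (base_blocks b w)
  = nwords b w s (size B) c.
Proof.
move=> s_gt0 B_lt c_le.
pose f (i : nat) (a : nat) :=
  (i \in slots s (size B) c) ==> (a == nth 0 B ((i - c) %/ s)).
transitivity (\prod_(i < w) count (f i) (iota 0 b)).
  rewrite -count_base_blocks; apply: eq_count => v /=.
  apply/allP/allP => [occ i|ok t].
    rewrite mem_iota /= add0n => i_w; apply/implyP => /mapP[t tk ->].
    by rewrite addKn mulKn //; apply: occ.
  rewrite mem_iota /= add0n => t_lt.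
  have := ok (c + s * t).
  rewrite /f addKn mulKn // (map_f (fun t => c + s * t)) ?mem_iota //=; apply.
  suff: s * t < s * size B by lia.
  by rewrite ltn_pmul2l.
apply: eq_bigr => i _; rewrite /f; case: ifP => [i_s|_] /=; last first.
  by rewrite count_predT size_iota.
rewrite (eq_count (a2 := pred1 (nth 0 B ((i - c) %/ s)))) //.
rewrite count_uniq_mem ?iota_uniq // mem_iota /= add0n B_lt // mem_nth //.
case/mapP: i_s => t + ->; by rewrite mem_iota addKn mulKn.
Qed.

(** The missing factors of [b ^ w] are one [b] for each slot inside the word, and
    there are at most [k] of those. *)
Lemma nwords_ge b w s k c : 0 < b -> b ^ w <= nwords b w s k c * b ^ k.
Proof.
move=> b_gt0.
have -> : b ^ w = nwords b w s k c
    * \prod_(i < w) (if nat_of_ord i \in slots s k c then b else 1).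
  rewrite -big_split /= -{1}[w]card_ord -prod_nat_const; apply: eq_bigr => i _.
  by case: ifP; rewrite ?mul1n ?muln1.
rewrite leq_mul2l -big_mkcond prod_nat_const; apply/orP; right.
apply: leq_pexp2l => //; set S := slots s k c.
have <- : size S = k by rewrite size_map size_iota.
rewrite cardE -(size_map (@nat_of_ord w)); apply: uniq_leq_size.
  by rewrite (map_inj_uniq (@ord_inj w)) enum_uniq.
by move=> _ /mapP[i + ->]; rewrite mem_enum.
Qed.

(** * The digits of zeta1 *)

Lemma L1S i : L1 i.+1 = L1 i + l1 i.+1 * size (X1 i.+1).
Proof. by rewrite /L1 big_nat_recr. Qed.

Lemma leq_L1 i j : i <= j -> L1 i <= L1 j.
Proof.
elim: j => [|j IHj]; first by rewrite leqn0 => /eqP ->.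
by rewrite leq_eqVlt => /orP[/eqP -> //|/IHj/leq_trans]; apply; rewrite L1S leq_addr.
Qed.

Lemma size_X1 i : 6 <= i -> size (X1 i) = i`! * i ^ i`!.
Proof. by move=> i6; rewrite /X1 ltnNge i6 /= size_Cblock. Qed.

Lemma size_flatten_nseq (T : Type) (s : seq T) n : size (flatten (nseq n s)) = n * size s.
Proof. by elim: n => //= n IHn; rewrite size_cat IHn mulSn. Qed.

Lemma size_E1_prefix i :
  size (flatten [seq flatten (nseq (l1 j) (X1 j)) | j <- iota 1 i]) = L1 i.
Proof.
elim: i => [|i IHi]; first by rewrite /L1 big_geq.
rewrite -[i.+1]addn1 iotaD map_cat flatten_cat size_cat IHi addn1 L1S /=.
by rewrite cats0 size_flatten_nseq add1n.
Qed.

Lemma level1E i n : L1 i < n <= L1 i.+1 -> level1 n = i.+1.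
Proof.
move=> /andP[lt_n n_le]; rewrite /level1; case: ex_minnP => j n_j min_j.
apply/eqP; rewrite eqn_leq min_j //= ltnNge; apply/negP => /leq_L1.
by rewrite leqNgt (leq_trans lt_n n_j).
Qed.

Lemma level1P n : 1 <= n ->
  exists i, [/\ level1 n = i.+1, L1 i < n, n <= L1 i.+1 & 6 <= i.+1].
Proof.
move=> n_gt0.
have [i [lt_n n_le]] : exists i, L1 i < n /\ n <= L1 i.+1.
  have [j] := L1_unbounded n; elim: j => [|j IHj] n_le.
    by move: n_le; rewrite /L1 big_geq // leqNgt n_gt0.
  by have [/IHj|lt_n] := leqP n (L1 j); last exists j.
exists i; split=> //; first by rewrite (level1E (i := i)) ?lt_n.
rewrite leqNgt; apply/negP => lt_i; move: n_le.
by rewrite L1S {1}/l1 lt_i mul0n addn0 leqNgt lt_n.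
Qed.

Lemma E1_copy i t q : t < l1 i.+1 -> q < size (X1 i.+1) ->
  E1 (L1 i + t * size (X1 i.+1) + q).+1 = nth 0 (X1 i.+1) q.
Proof.
move=> t_lt q_lt; set x := size _.
have in_level : t * x + q < l1 i.+1 * x.
  apply: (@leq_trans (t.+1 * x)); first by rewrite mulSn addnC ltn_add2r.
  by rewrite leq_mul2r t_lt orbT.
rewrite /E1 (level1E (i := i)); last by rewrite L1S -/x; lia.
rewrite -[X in iota _ X]addn1 iotaD map_cat flatten_cat /= cats0 add1n.
rewrite nth_cat size_E1_prefix.
rewrite ltnNge -addnA leq_addr /= addKn (@nth_flatten_uniform _ _ _ x) //.
  by rewrite nth_nseq t_lt.
by rewrite all_nseq eqxx orbT.
Qed.

Lemma E1_word i t u c : 6 <= i.+1 -> t < l1 i.+1 -> u < i.+1 ^ i.+1`! -> c < i.+1`! ->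
  E1 (L1 i + t * size (X1 i.+1) + (u * i.+1`! + c)).+1
  = nth 0 (nth [::] (base_blocks i.+1 i.+1`!) u) c.
Proof.
move=> i6 t_lt u_lt c_lt; rewrite E1_copy //; last first.
  rewrite size_X1 //; apply: (@leq_trans (u.+1 * i.+1`!)).
    by rewrite mulSn addnC ltn_add2r.
  by rewrite mulnC leq_mul2l u_lt orbT.
by rewrite /X1 ltnNge i6 /= nth_flatten_uniform // all_size_base_blocks.
Qed.

Lemma l1_gt0 i : 6 <= i -> 0 < l1 i.
Proof. by rewrite leqNgt /l1 => /negbTE ->; rewrite muln_gt0 !expn_gt0. Qed.

Lemma E1_level n : 1 <= n -> exists i t u c,
  [/\ 6 <= i.+1, level1 n = i.+1, u < i.+1 ^ i.+1`!, c < i.+1`!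
    & t < l1 i.+1 /\ n = (L1 i + t * size (X1 i.+1) + (u * i.+1`! + c)).+1].
Proof.
move=> /level1P[i [lev lt_n n_le i6]].
pose x := size (X1 i.+1); pose d := n.-1 - L1 i.
have w_gt0 : 0 < i.+1`! by apply: fact_gt0.
have x_gt0 : 0 < x by rewrite /x size_X1 // muln_gt0 w_gt0 expn_gt0.
have d_lt : d < l1 i.+1 * x by move: n_le; rewrite L1S -/x /d; lia.
exists i, (d %/ x), (d %% x %/ i.+1`!), (d %% x %% i.+1`!); split=> //.
- by rewrite ltn_divLR // mulnC -size_X1 // ltn_mod.
- by rewrite ltn_mod.
split; first by rewrite ltn_divLR.
by rewrite -divn_eq -addnA -divn_eq /d; lia.
Qed.

(** Arithmetic form of [E1], from which its computability is read off: [q] is the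
    place of [n] in its copy of [X_i], and the quotients locate the word and the
    letter in that copy. *)
Definition E1_formula n :=
  let i := level1 n in let q := (n.-1 - L1 i.-1) %% (i`! * i ^ i`!) in
  q %/ i`! %/ i ^ (i`!.-1 - q %% i`!) %% i.

Lemma E1_formulaE n : 1 <= n -> E1 n = E1_formula n.
Proof.
move=> /E1_level[i [t [u [c [i6 lev u_lt c_lt [t_lt nE]]]]]].
rewrite /E1_formula lev /= {1 2 3}nE E1_word // nth_base_blocks //.
have q_lt : u * i.+1`! + c < i.+1`! * i.+1 ^ i.+1`!.
  apply: (@leq_trans (u.+1 * i.+1`!)); first by rewrite mulSn addnC ltn_add2r.
  by rewrite mulnC leq_mul2l u_lt orbT.
rewrite -addnA addKn size_X1 // modnMDl (modn_small q_lt).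
by rewrite divnMDl ?fact_gt0 // modnMDl (divn_small c_lt) addn0 (modn_small c_lt).
Qed.

Lemma E1_lt n : 1 <= n -> E1 n < R1 n.
Proof.
move=> n1; rewrite E1_formulaE // /E1_formula ltn_mod.
by have [i [t [u [c [_ -> _ _ _]]]]] := E1_level n1.
Qed.

Lemma R1_ge n : 1 <= n -> 2 <= R1 n.
Proof. by move=> /level1P[i [? _ _ ?]]; rewrite /R1 /b1; lia. Qed.

(** * Blocks in a list of all words *)

Lemma count_nth (T : Type) (x0 : T) (f : pred T) ss :
  count f ss = \sum_(u < size ss) f (nth x0 ss u).
Proof.
rewrite -sum1_count (big_nth x0) big_mkord big_mkcond /=.
by apply: eq_bigr => i _; case: (f _).
Qed.

Lemma sum_residues_ge m r a n : 0 < m -> n %/ m <= \sum_(c < n) (a + c == r %[mod m]).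
Proof.
move=> m_gt0; rewrite -(big_mkord xpredT (fun c => nat_of_bool (a + c == r %[mod m]))).
rewrite {2}(divn_eq n m) big_mkord big_split_ord /=.
apply: leq_trans (leq_addr _ _).
rewrite (sum_ord_mul (fun c => a + c == r %[mod m])).
rewrite -[leqLHS]muln1 -[X in X * 1]card_ord -sum_nat_const; apply: leq_sum => u _.
(* The place in each group of m consecutive integers that has residue r. *)
pose j := (r %% m + (m - a %% m)) %% m.
have j_lt : j < m by rewrite ltn_mod.
rewrite (bigD1 (Ordinal j_lt)) //=; apply: leq_trans (leq_addr _ _).
rewrite lt0b addnCA modnMDl; apply/eqP.
have a_le : a %% m <= m by rewrite ltnW // ltn_mod.
by rewrite modnDmr -modnDml addnCA subnKC // modnDr modn_mod.
Qed.

(** A window of a sequence [E] that starts at [a] and spells all the words of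
    length [w] over [b] letters. *)
Section Window.
Variables (b w m r s k a : nat) (E : nat -> nat).
Hypotheses (b_gt0 : 0 < b) (s_gt0 : 0 < s) (m_w : m %| w).
Hypothesis E_words : forall u c, u < b ^ w -> c < w ->
  E (a + (u * w + c)) = nth 0 (nth [::] (base_blocks b w) u) c.

Definition class_pattern B p := (p == r %[mod m]) && pattern s E B p.

Definition column B c := \sum_(u < b ^ w) class_pattern B (a + (u * w + c)).

(** The part of the count that depends on a block only through its length:
    readings that stay inside one word. *)
Definition inner_mass :=
  \sum_(0 <= c < w - s * k) (a + c == r %[mod m]) * nwords b w s k c.

Lemma count_window B :
  count (class_pattern B) (iota a (b ^ w * w)) = \sum_(0 <= c < w) column B c.
Proof.
rewrite count_iota (sum_ord_mul (fun j => class_pattern B (a + j))) exchange_big.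
by rewrite big_mkord.
Qed.

(** As [m] divides [w], the residue mod [m] depends only on the place [c] in the
    word; what remains to count are the words that carry the block at [c]. *)
Lemma column_inner B c : size B = k -> {in B, forall d, d < b} ->
  c + s * k <= w -> c < w ->
  column B c = (a + c == r %[mod m]) * nwords b w s k c.
Proof.
move=> B_k B_lt c_le c_lt; rewrite /column -B_k -count_pattern_words ?B_k //.
rewrite (count_nth [::]) size_base_blocks big_distrr /=; apply: eq_bigr => u _.
rewrite -mulnb /class_pattern; congr (nat_of_bool _ * nat_of_bool _).
  have /dvdnP[h wE] := m_w.
  have -> : a + (u * w + c) = (u * h) * m + (a + c) by rewrite -mulnA -wE addnCA.
  by rewrite modnMDl.
apply: eq_in_all => t; rewrite mem_iota add0n B_k /= => t_lt.
rewrite -[a + _ + _]addnA -[u * w + _ + _]addnA E_words //.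
apply: leq_trans c_le; rewrite ltn_add2l.
by rewrite ltn_pmul2l.
Qed.

Lemma window_lower B : size B = k -> {in B, forall d, d < b} ->
  inner_mass <= count (class_pattern B) (iota a (b ^ w * w)).
Proof.
move=> B_k B_lt; rewrite count_window (big_cat_nat (n := w - s * k)) ?leq_subr //=.
apply: leq_trans (leq_addr _ _); rewrite /inner_mass !big_nat.
by apply: leq_sum => c /= c_lt; rewrite column_inner //; lia.
Qed.

(** The last [s * k] places of each word are counted as if the block always
    occurred there. *)
Lemma window_upper B : size B = k -> {in B, forall d, d < b} ->
  count (class_pattern B) (iota a (b ^ w * w)) <= inner_mass + s * k * b ^ w.
Proof.
move=> B_k B_lt; rewrite count_window (big_cat_nat (n := w - s * k)) ?leq_subr //=.
apply: leq_add.
  rewrite /inner_mass !big_nat.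
  by apply: leq_sum => c /= c_lt; rewrite column_inner //; lia.
apply: (@leq_trans (\sum_(w - s * k <= c < w) b ^ w)).
  apply: leq_sum => c _; rewrite /column -[leqRHS]muln1.
  rewrite -[X in _ <= X * 1]card_ord -sum_nat_const.
  by apply: leq_sum => u _; apply: leq_b1.
by rewrite sum_nat_const_nat leq_mul2r; apply/orP; right; lia.
Qed.

Lemma inner_mass_ge : 0 < m ->
  (w - s * k) %/ m * b ^ w <= inner_mass * b ^ k.
Proof.
move=> m_gt0; rewrite /inner_mass big_distrl /=.
have := @sum_residues_ge m r a (w - s * k) m_gt0.
rewrite -(leq_pmul2r (m := b ^ w)) ?expn_gt0 ?b_gt0 // => /leq_trans; apply.
rewrite big_mkord big_distrl /=; apply: leq_sum => c _.
by rewrite -mulnA leq_mul2l nwords_ge // orbT.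
Qed.

End Window.

(** Induction on [k]: passing from [i] to [i + 1] multiplies the factorial by
    [i + 1], while [(i + 2) ^ k.+1] is at most [2 ^ k.+1 * (i + 1) ^ k.+1]. *)
(** * One copy of X_i, and its size against the preceding level *)

Lemma fact_dominates K k : exists i0, forall i, i0 <= i -> K * i.+1 ^ k <= i`!.
Proof.
elim: k K => [|k IHk] K.
  by exists K => i /leq_trans; rewrite expn0 muln1; apply; elim: i => // -[|i] // IHi;
    rewrite factS mulSn -add1n leq_add // ?fact_gt0 // (leq_trans IHi) // leq_pmull.
have [i0 IH] := IHk (K * 2 ^ k.+1); exists i0.+1 => -[//|i]; rewrite ltnS => /IH le_i.
rewrite factS; apply: (@leq_trans (i.+1 * (K * 2 ^ k.+1 * i.+1 ^ k))); last first.
  by rewrite leq_mul2l le_i orbT.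
rewrite mulnCA -!mulnA leq_mul2l; apply/orP; right.
rewrite [leqRHS](_ : _ = 2 ^ k.+1 * i.+1 ^ k.+1); last by rewrite [i.+1 ^ k.+1]expnS; lia.
by rewrite -expnMn leq_exp2r //; lia.
Qed.

Lemma sqr_le_expn2 n : 4 <= n -> n * n <= 2 ^ n.
Proof.
elim: n => // n IHn; rewrite leq_eqVlt => /orP[/eqP <- //|n4].
have := IHn n4; rewrite expnS; nia.
Qed.

Section Copies.
Variables (m r s : nat).
Hypotheses (m_gt0 : 0 < m) (s_gt0 : 0 < s).

Let copy_start i t := (L1 i + t * size (X1 i.+1)).+1.

Lemma copy_words i t : 6 <= i.+1 -> t < l1 i.+1 ->
  forall u c, u < i.+1 ^ i.+1`! -> c < i.+1`! ->
  E1 (copy_start i t + (u * i.+1`! + c)) = nth 0 (nth [::] (base_blocks i.+1 i.+1`!) u) c.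
Proof. by move=> i6 t_lt u c u_lt c_lt; rewrite addSn E1_word. Qed.

Lemma inner_mass_dominates K k : exists i0, forall i a, i0 <= i ->
  K * i.+1 ^ i.+1`! <= inner_mass i.+1 i.+1`! m r s k a /\ m <= i.+1.
Proof.
have [i0 H] := fact_dominates (m * K.+1 + s * k) k.
exists (i0 + m) => i a i_ge; split; last by lia.
have i1 : 0 < i.+1 ^ k by rewrite expn_gt0.
rewrite -(leq_pmul2r i1); apply: leq_trans (inner_mass_ge _ _ _ _ _ _ _) => //.
rewrite -mulnA mulnCA mulnC leq_mul2r; apply/orP; right.
rewrite leq_divRL //.
have := H i.+1 (leq_trans (leq_trans (leq_addr _ _) i_ge) (leqnSn _)).
set p := i.+1 ^ k in i1 *; set p' := i.+2 ^ k; set w := i.+1`!.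
have pp : p <= p' by rewrite /p /p'; case: (k) => // k'; rewrite leq_exp2r.
nia.
Qed.

(** In one copy of [X_i] the counts differ by at most [s * k * i ^ i!], the number
    of readings that may leave their word, while both are at least about
    [i! / m * i ^ (i! - k)]. *)
Lemma copy_balanced K B1 B2 : size B1 = size B2 ->
  exists i0, forall i t, i0 <= i -> t < l1 i.+1 ->
    K * count (class_pattern m r s E1 B1) (iota (copy_start i t) (size (X1 i.+1)))
    <= K.+1 * count (class_pattern m r s E1 B2) (iota (copy_start i t) (size (X1 i.+1))).
Proof.
move=> B12; pose k := size B1.
have [i0 H] := inner_mass_dominates (K * (s * k)) k.
exists (i0 + 5 + \sum_(d <- B1 ++ B2) d) => i t i_ge t_lt.
have i6 : 6 <= i.+1 by lia.
have [le_mass m_le] := H i (copy_start i t) ltac:(lia).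
have m_w : m %| i.+1`! by apply: dvdn_fact; rewrite m_gt0.
have B_lt d : d \in B1 ++ B2 -> d < i.+1.
  move=> dB; rewrite ltnS (leq_trans _ i_ge) // (leq_trans _ (leq_addl _ _)) //.
  by rewrite (big_rem d) //= leq_addr.
rewrite size_X1 // [_`! * _]mulnC.
have U := @window_upper _ _ m r s k _ E1 (ltn0Sn i) s_gt0 m_w
  (copy_words i6 t_lt) B1 erefl.
have L := @window_lower _ _ m r s k _ E1 (ltn0Sn i) s_gt0 m_w
  (copy_words i6 t_lt) B2 (esym B12).
have {}U := U (fun d dB => B_lt d ltac:(by rewrite mem_cat dB)).
have {}L := L (fun d dB => B_lt d ltac:(by rewrite mem_cat dB orbT)).
move: U L le_mass.
set M := inner_mass _ _ _ _ _ _ _; set c1 := count _ _; set c2 := count _ _.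
by move: (_ ^ _) => N; nia.
Qed.

Lemma copy_mass B : exists i0, forall i t, i0 <= i -> t < l1 i.+1 ->
  i.+1 ^ i.+1`! <=
  count (class_pattern m r s E1 B) (iota (copy_start i t) (size (X1 i.+1)))
  * i.+1 ^ size B.
Proof.
have [i0 H] := inner_mass_dominates 0 (size B).
have [i1 H1] := fact_dominates (m + s * size B) 0.
exists (i0 + i1 + 5 + \sum_(d <- B) d) => i t i_ge t_lt.
have i6 : 6 <= i.+1 by lia.
have [_ m_le] := H i (copy_start i t) ltac:(lia).
have := H1 i.+1 ltac:(lia); rewrite expn0 muln1 => w_ge.
have m_w : m %| i.+1`! by apply: dvdn_fact; rewrite m_gt0.
have B_lt : {in B, forall d, d < i.+1}.
  move=> d dB; rewrite ltnS (leq_trans _ i_ge) // (leq_trans _ (leq_addl _ _)) //.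
  by rewrite (big_rem d) //= leq_addr.
rewrite size_X1 // [_`! * _]mulnC.
have L := @window_lower _ _ m r s _ _ E1 (ltn0Sn i) s_gt0 m_w
  (copy_words i6 t_lt) B erefl B_lt.
apply: (@leq_trans (inner_mass i.+1 i.+1`! m r s (size B) (copy_start i t)
    * i.+1 ^ size B)); last by rewrite leq_mul2r L orbT.
apply: leq_trans (inner_mass_ge _ _ _ _ _ _ _) => //.
by rewrite leq_pmull // divn_gt0 //; lia.
Qed.

End Copies.

(** The hypothesis is the lower bound that [copy_mass] gives for the number [c] of
    occurrences in a whole level.  The exponent in [l1] is such that [l_i] and
    the length of [X_(i+1)] share the factor [(i + 1) ^ (i! * i)].  It remains to
    compare [K * (i + 1)! * i ^ k * (i + 1) ^ i!], where the first three factors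
    are at most [(i!) ^ 2 <= 2 ^ i!], with [(3 * i) ^ i!], which is at least
    [2 ^ i! * (i + 1) ^ i!]. *)
Lemma next_copy_negligible K k : exists i0, forall i c, i0 <= i ->
  l1 i.+1 * i.+1 ^ i.+1`! <= c * i.+1 ^ k -> K * size (X1 i.+2) <= c.
Proof.
have [i0 H] := fact_dominates K k.+1; exists (i0 + 5) => i c i_ge c_ge.
have i1 : 0 < i.+1 ^ k by rewrite expn_gt0.
rewrite -(leq_pmul2r i1); apply: leq_trans c_ge.
rewrite size_X1; last by lia.
rewrite /l1 ltnNge (_ : 6 <= i.+1) /=; last by lia.
have := H i.+1 ltac:(lia).
have -> : i.+2 ^ i.+2`! = i.+2 ^ (i.+1`! * i.+1) * i.+2 ^ i.+1`!.
  by rewrite -expnD factS mulSn addnC mulnC.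
rewrite [i.+2`!]factS.
have w4 : 4 <= i.+1`!.
  by apply: leq_trans (fact_geq _); lia.
have := sqr_le_expn2 w4.
have : 2 ^ i.+1`! * i.+2 ^ i.+1`! <= 3 ^ i.+1`! * i.+1 ^ i.+1`!.
  by rewrite -!expnMn leq_exp2r ?fact_gt0 //; lia.
have : i.+1 ^ k * i.+2 <= i.+2 ^ k.+1.
  rewrite expnSr leq_mul2r; apply/orP; right; case: (k) => // k'; rewrite leq_exp2r //.
move: (i.+1`!) => w le_k le_23 le_ww le_K.
move: (i.+2 ^ (w * i.+1)) => tail.
move: (3 ^ w) (i.+2 ^ w) (i.+1 ^ w) (2 ^ w) le_23 le_ww.
move: (i.+1 ^ k) (i.+2 ^ k.+1) le_k le_K => y z le_k le_K w3 wi2 wi1 w2 le_23 le_ww.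
rewrite (_ : K * _ * _ = (w * (K * (y * i.+2))) * wi2 * tail); last by lia.
rewrite (_ : w3 * _ * _ = w3 * wi1 * tail); last by lia.
rewrite leq_mul2r; apply/orP; right.
apply: leq_trans le_23; rewrite leq_mul2r; apply/orP; right.
apply: leq_trans le_ww; rewrite leq_mul2l; apply/orP; right.
by apply: leq_trans le_K; rewrite leq_mul2l le_k orbT.
Qed.

(** * Asymptotically equal counts *)

Lemma L1_ge n : n <= L1 (n + 5).
Proof.
elim: n => // n IHn; rewrite addSn L1S -[n.+1]addn1 leq_add //.
have n6 : 6 <= (n + 5).+1 by rewrite -addnS leq_addl.
by rewrite muln_gt0 l1_gt0 // size_X1 // muln_gt0 fact_gt0 expn_gt0.
Qed.

Section Frequency.
Variables (m r s : nat).
Hypotheses (m_gt0 : 0 < m) (s_gt0 : 0 < s).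

(** The frequency results are stated for predicates that coincide from some
    point on with the pattern in [E1], so that they apply directly to the digits
    truncated by [Q]. *)
Definition eventually_pattern (B : seq nat) (o : pred nat) :=
  exists p0, forall p, p0 <= p -> o p = class_pattern m r s E1 B p.

Notation C o n := (count o (iota 1 n)).

Lemma count_step (o : pred nat) a n : C o (a + n) = C o a + count o (iota a.+1 n).
Proof. by rewrite iotaD count_cat add1n. Qed.

Lemma count_copies_eq B o : eventually_pattern B o -> exists i0, forall i t, i0 <= i ->
  count o (iota (L1 i + t * size (X1 i.+1)).+1 (size (X1 i.+1))) =
  count (class_pattern m r s E1 B) (iota (L1 i + t * size (X1 i.+1)).+1 (size (X1 i.+1))).
Proof.
case=> p0 oE; exists (p0 + 5) => i t i_ge; apply: eq_in_count => p.
rewrite mem_iota => /andP[p_ge _]; apply: oE.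
have := leq_trans (L1_ge p0) (leq_L1 i_ge); lia.
Qed.

Lemma pattern_mass K B o : eventually_pattern B o -> exists i0, forall i, i0 <= i ->
  K * size (X1 i.+2) <= C o (L1 i.+1).
Proof.
move=> /count_copies_eq[i0 oE]; have [i1 M] := copy_mass r m_gt0 s_gt0 B.
have [i2 N] := next_copy_negligible K (size B).
exists (i0 + i1 + i2) => i i_ge; apply: N; first by lia.
rewrite L1S count_step mulnDl; apply: leq_trans (leq_addl _ _).
have : l1 i.+1 <= l1 i.+1 by [].
elim: {1 3 4}(l1 i.+1) => // t IHt t_lt.
rewrite [t.+1 * size _]mulSnr iotaD count_cat [t.+1 * _]mulSnr mulnDl.
apply: leq_add; first by rewrite IHt // ltnW.
by rewrite addSn oE ?M //; lia.
Qed.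

(** Up to the end of the last complete copy the inequality is the sum of those for
    the single copies, with an error that comes from the first levels; this error
    and the incomplete copy are absorbed by the occurrences in the preceding
    level. *)
Lemma frequency K B1 B2 o1 o2 : size B1 = size B2 ->
  eventually_pattern B1 o1 -> eventually_pattern B2 o2 ->
  exists n0, forall n, n0 <= n -> K * C o1 n <= K.+1 * C o2 n.
Proof.
move=> B12 o1P o2P.
have [i1 o1E] := count_copies_eq o1P; have [i2 o2E] := count_copies_eq o2P.
(* Starting from 2 K leaves a margin of 1 / (2 K) for the two error terms. *)
have [i3 bal] := copy_balanced r m_gt0 s_gt0 (2 * K) B12.
pose i0 := i1 + i2 + i3 + 6.
have [i4 mass] := pattern_mass (2 * K * L1 i0 + 2 * K) o2P.
have copies i t : i0 <= i -> t <= l1 i.+1 ->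
    2 * K * C o1 (L1 i) <= 2 * K * L1 i0 + (2 * K).+1 * C o2 (L1 i) ->
    2 * K * C o1 (L1 i + t * size (X1 i.+1))
    <= 2 * K * L1 i0 + (2 * K).+1 * C o2 (L1 i + t * size (X1 i.+1)).
  move=> i_ge + base; elim: t => [|t IHt] t_lt; first by rewrite mul0n addn0.
  rewrite [t.+1 * _]mulSnr [L1 i + (_ + _)]addnA !(count_step _ (L1 i + t * _)).
  rewrite [_ * (_ + count _ _)]mulnDr.
  rewrite [(2 * K).+1 * (_ + _)]mulnDr addnA.
  apply: leq_add; first by rewrite IHt // ltnW.
  by rewrite o1E ?o2E ?bal // /i0; lia.
have levels i : i0 <= i ->
    2 * K * C o1 (L1 i) <= 2 * K * L1 i0 + (2 * K).+1 * C o2 (L1 i).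
  elim: i => [|i IHi]; first by rewrite /i0; lia.
  rewrite leq_eqVlt => /orP[/eqP <-|i_ge].
    apply: leq_trans (leq_addr _ _); rewrite leq_mul2l; apply/orP; right.
    by apply: leq_trans (count_size _ _) _; rewrite size_iota.
  by rewrite L1S; apply: copies (leqnn _) (IHi i_ge).
exists (L1 (i0 + i4).+2).+1 => n n_ge.
have [i [_ i_lt i_le i6]] := level1P (leq_trans (ltn0Sn _) n_ge).
have i_ge : (i0 + i4).+2 <= i.
  rewrite leqNgt; apply/negP => /leq_L1 le; have := leq_trans i_le le.
  by move: n_ge; lia.
set x := size (X1 i.+1).
have x_gt0 : 0 < x by rewrite /x size_X1 // muln_gt0 fact_gt0 expn_gt0.
pose t := (n - L1 i) %/ x; pose q := (n - L1 i) %% x.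
have nE : n = L1 i + t * x + q by rewrite -addnA -divn_eq subnKC // ltnW.
have q_lt : q < x by rewrite ltn_mod.
have t_le : t <= l1 i.+1.
  have := i_le; rewrite L1S nE -/x -addnA leq_add2l => le.
  have : t * x <= l1 i.+1 * x by lia.
  by rewrite leq_pmul2r.
have i0i : i0 <= i by lia.
have := copies i t i0i t_le (levels i i0i); rewrite -/x => le_t.
have mono a b o : a <= b -> C o a <= C o b.
  by move=> /subnKC <-; rewrite count_step leq_addr.
have mass_i : (2 * K * L1 i0 + 2 * K) * x <= C o2 (L1 i).
  case: (i) i_ge @x {x_gt0 t q nE q_lt t_le le_t i_lt i_le i6 i0i} => // j j_ge.
  by apply: mass; lia.
have rest : count o1 (iota (L1 i + t * x).+1 q) <= q.
  by apply: leq_trans (count_size _ _) _; rewrite size_iota.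
have C1n : C o1 n = C o1 (L1 i + t * x) + count o1 (iota (L1 i + t * x).+1 q).
  by rewrite {1}nE count_step.
have C2n : C o2 (L1 i + t * x) <= C o2 n by apply: mono; rewrite [leqRHS]nE leq_addr.
have C2L : C o2 (L1 i) <= C o2 n by apply: mono; rewrite ltnW.
move: C1n C2n C2L mass_i le_t rest; clear -x_gt0 q_lt.
move: (C o1 n) (C o1 (L1 i + t * x)) (C o2 n) (C o2 (L1 i + t * x)) (C o2 (L1 i))
  (count o1 (iota (L1 i + t * x).+1 q)) (L1 i0).
by move=> c1n c1 c2n c2 cL cq L -> ? ? ? ? ?; nia.
Qed.

Lemma pattern_unbounded D B o : eventually_pattern B o ->
  exists n0, forall n, n0 <= n -> D <= C o n.
Proof.
move=> /(pattern_mass D)[i0 H]; exists (L1 (i0 + 5).+1) => n n_ge.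
have := H (i0 + 5) (leq_addr _ _); rewrite -(subnKC n_ge) count_step.
have : 0 < size (X1 (i0 + 5).+2) by rewrite size_X1 ?muln_gt0 ?fact_gt0 ?expn_gt0 //; lia.
nia.
Qed.

End Frequency.

End Combinatorics.

Import Order.TTheory GRing.Theory Num.Theory.
Import numFieldNormedType.Exports.
Local Open Scope classical_set_scope.
Local Open Scope ring_scope.

(** * Digits of Cantor series *)

Section Cantor.
Variable R : realType.
Implicit Types Q E : nat -> nat.

Definition denom Q (N : nat) : nat := (\prod_(1 <= j < N.+1) Q j)%N.

(** The partial sums of the series are [numer Q E N / denom Q N]. *)
Fixpoint numer Q E (N : nat) : nat :=
  if N is N'.+1 then (numer Q E N' * Q N'.+1 + E N'.+1)%N else 0%N.

Lemma denomS Q N : denom Q N.+1 = (denom Q N * Q N.+1)%N.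
Proof. by rewrite /denom big_nat_recr. Qed.

Lemma denom_ge Q N : basic_sequence Q -> (2 ^ N <= denom Q N)%N.
Proof.
move=> bQ; elim: N => [|N IHN]; first by rewrite /denom big_geq.
by rewrite denomS expnSr leq_mul // bQ.
Qed.

Lemma denom_gt0 Q N : basic_sequence Q -> (0 < denom Q N)%N.
Proof. by move=> /(denom_ge N); apply: leq_trans; rewrite expn_gt0. Qed.

Lemma eq_numer Q E E' N : (forall n, (1 <= n)%N -> E n = E' n) ->
  numer Q E N = numer Q E' N.
Proof. by move=> EE'; elim: N => //= N ->; rewrite EE'. Qed.

Lemma partial_cantor_sum Q E N : basic_sequence Q ->
  \sum_(1 <= n < N.+1) (E n)%:R / \prod_(1 <= j < n.+1) (Q j)%:R
  = (numer Q E N)%:R / (denom Q N)%:R :> R.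
Proof.
move=> bQ; elim: N => [|N IHN]; first by rewrite big_geq // mul0r.
rewrite big_nat_recr //= IHN -natr_prod -/(denom Q N.+1) denomS natrD !natrM.
have D0 : (denom Q N)%:R != 0 :> R by rewrite pnatr_eq0 -lt0n denom_gt0.
have Q0 : (Q N.+1)%:R != 0 :> R by rewrite pnatr_eq0 -lt0n (leq_trans _ (bQ N.+1 _)).
by rewrite mulrDl -mulf_div divff // mulr1.
Qed.

Lemma eq_cantor_sum Q E E' : (forall n, (1 <= n)%N -> E n = E' n) ->
  cantor_sum R Q E = cantor_sum R Q E'.
Proof.
move=> EE'; rewrite /cantor_sum; congr (limn _); apply/funext => N.
by apply: eq_big_nat => n /andP[n1 _]; rewrite EE'.
Qed.

Section Bounds.
Variables Q E : nat -> nat.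
Hypothesis bQ : basic_sequence Q.
Hypothesis E_lt : forall n, (1 <= n)%N -> (E n < Q n)%N.

Let lower N : R := (numer Q E N)%:R / (denom Q N)%:R.
Let upper N : R := (numer Q E N).+1%:R / (denom Q N)%:R.

Let denomR_gt0 N : 0 < (denom Q N)%:R :> R.
Proof. by rewrite ltr0n denom_gt0. Qed.

Lemma lower_nondecreasing : nondecreasing_seq lower.
Proof.
apply/nondecreasing_seqP => N; rewrite /lower ler_pdivrMr // mulrAC ler_pdivlMr //.
by rewrite -!natrM ler_nat /= denomS; nia.
Qed.

Lemma upper_step N :
  (upper N.+1 <= upper N) /\ (E N.+1 <> (Q N.+1).-1 -> upper N.+1 < upper N).
Proof.
have En := E_lt (ltn0Sn N); have Dn := denom_gt0 N bQ.
split=> [|Enot]; rewrite /upper.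
  rewrite ler_pdivrMr // mulrAC ler_pdivlMr // -!natrM ler_nat /= denomS; nia.
rewrite ltr_pdivrMr // mulrAC ltr_pdivlMr // -!natrM ltr_nat /= denomS.
have : (E N.+1 < (Q N.+1).-1)%N by move: Enot En; lia.
nia.
Qed.

Lemma upper_nonincreasing : nonincreasing_seq upper.
Proof. by apply/nonincreasing_seqP => N; case: (upper_step N). Qed.

Lemma lower_le_upper N M : lower N <= upper M.
Proof.
apply: (@le_trans _ _ (lower (maxn N M))).
  by apply: lower_nondecreasing; rewrite leq_maxl.
apply: (@le_trans _ _ (upper (maxn N M))); last first.
  by apply: upper_nonincreasing; rewrite leq_maxr.
by rewrite /lower /upper ler_pM2r ?invr_gt0 // ler_nat.
Qed.

Lemma lower_cvg : cvgn lower.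
Proof.
apply: nondecreasing_is_cvgn; first exact: lower_nondecreasing.
by exists (upper 0) => _ [N _ <-]; apply: lower_le_upper.
Qed.

Lemma cantor_sumE : cantor_sum R Q E = limn lower.
Proof.
rewrite /cantor_sum; congr (limn _); apply/funext => N.
exact: partial_cantor_sum.
Qed.

Lemma cantor_sum_ge N : (numer Q E N)%:R / (denom Q N)%:R <= cantor_sum R Q E.
Proof.
rewrite cantor_sumE; apply: nondecreasing_cvgn_le.
  exact: lower_nondecreasing.
exact: lower_cvg.
Qed.

Lemma cantor_sum_le N : cantor_sum R Q E <= (numer Q E N).+1%:R / (denom Q N)%:R.
Proof.
rewrite cantor_sumE; apply: limr_le; first exact: lower_cvg.
by near=> M; apply: lower_le_upper.
Unshelve. all: by end_near. Qed.

Hypothesis E_not_max : forall N, exists2 n, (N < n)%N & E n <> (Q n).-1.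

(** At a digit that is not maximal the upper bound decreases strictly. *)
Lemma cantor_sum_lt N : cantor_sum R Q E < (numer Q E N).+1%:R / (denom Q N)%:R.
Proof.
have [[//|M] N_lt EM] := E_not_max N.
apply: (le_lt_trans (cantor_sum_le M.+1)).
have [_ /(_ EM)/lt_le_trans] := upper_step M; apply.
by apply: upper_nonincreasing; rewrite -ltnS.
Qed.

(** The number determines all the numerators, hence all the digits. *)
Lemma numer_floor N : Num.floor (cantor_sum R Q E * (denom Q N)%:R) = (numer Q E N)%:Z.
Proof.
apply: floor_def; rewrite -ler_pdivrMr // cantor_sum_ge /=.
by rewrite -ltr_pdivlMr // intrD natr1 cantor_sum_lt.
Qed.

Lemma cantor_sum_floor : Num.floor (cantor_sum R Q E) = 0.
Proof. by have := numer_floor 0; rewrite /denom big_geq // mulr1. Qed.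

Lemma cantor_expansion_sum : cantor_expansion Q (cantor_sum R Q E) E.
Proof. by split=> //; rewrite cantor_sum_floor add0r. Qed.

End Bounds.

Lemma cantor_digits_unique Q E E' : basic_sequence Q ->
  cantor_expansion Q (cantor_sum R Q E) E -> cantor_expansion Q (cantor_sum R Q E) E' ->
  forall n, (1 <= n)%N -> E' n = E n.
Proof.
move=> bQ [_ E_lt E_max] [+ E'_lt E'_max].
rewrite cantor_sum_floor // add0r => EE' [//|n] _.
have numerE N : numer Q E' N = numer Q E N.
  by apply: (can_inj absz_nat); rewrite /= -!(numer_floor bQ) // EE'.
have := numerE n.+1; rewrite /= numerE; exact: addnI.
Qed.

Lemma digit_cantor_sum Q E : basic_sequence Q ->
  (forall n, (1 <= n)%N -> (E n < Q n)%N) ->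
  (forall N, exists2 n, (N < n)%N & E n <> (Q n).-1) ->
  forall n, (1 <= n)%N -> digit Q (cantor_sum R Q E) n = E n.
Proof.
move=> bQ E_lt E_max; have Eexp := cantor_expansion_sum bQ E_lt E_max.
apply: (cantor_digits_unique bQ Eexp).
by rewrite /digit; case: xgetP => [D -> //|/(_ E)]; case.
Qed.

End Cantor.

(** * Recursive functions *)

Section Recursive.
Local Open Scope nat_scope.

Lemma eq_recursive n (f g : n.-tuple nat -> nat) : recursive f -> f =1 g -> recursive g.
Proof. by move=> rf /funext <-. Qed.

Definition recursive2 (f : nat -> nat -> nat) :=
  recursive (fun v : 2.-tuple nat => f (tnth v ord0) (tnth v (inord 1))).

Definition recursive3 (f : nat -> nat -> nat -> nat) :=
  recursive (fun v : 3.-tuple nat =>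
    f (tnth v ord0) (tnth v (inord 1)) (tnth v (inord 2))).

Lemma rec_comp1 n u (f : n.-tuple nat -> nat) :
  computable_sequence u -> recursive f -> recursive (fun v => u (f v)).
Proof.
move=> ru rf; apply: (eq_recursive (rec_comp ru (fun=> rf))) => v.
by rewrite /thead tnth_mktuple.
Qed.

Lemma rec_comp2 n u (f g : n.-tuple nat -> nat) :
  recursive2 u -> recursive f -> recursive g -> recursive (fun v => u (f v) (g v)).
Proof.
move=> ru rf rg.
pose h (i : 'I_2) := if i == ord0 then f else g.
have rh i : recursive (h i) by rewrite /h; case: ifP.
apply: (eq_recursive (rec_comp ru rh)) => v.
by rewrite !tnth_mktuple /h /= -val_eqE /= inordK.
Qed.

Lemma rec_const n c : recursive (fun _ : n.-tuple nat => c).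
Proof. by elim: c => [|c IHc]; [exact: rec_zero|exact: (rec_comp1 rec_succ IHc)]. Qed.

Lemma rec_prim1 h g : recursive2 g -> (forall y, h y.+1 = g y (h y)) ->
  computable_sequence h.
Proof.
move=> rg hS.
by apply: (rec_prim (rec_const 0 (h 0)) rg) => [v|y v];
  rewrite ?theadE // hS !(tnth_nth 0) /= inordK.
Qed.

Lemma rec_prim2 h f g : computable_sequence f -> recursive3 g ->
  (forall a, h 0 a = f a) -> (forall y a, h y.+1 a = g y (h y a) a) ->
  recursive2 h.
Proof.
move=> rf rg h0 hS.
by apply: (rec_prim rf rg) => [v|y v]; rewrite ?h0 ?hS /thead !(tnth_nth 0) /= ?inordK.
Qed.

Lemma rec_succ1 n (f : n.-tuple nat -> nat) :
  recursive f -> recursive (fun v => (f v).+1).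
Proof. exact: (rec_comp1 rec_succ). Qed.

Lemma rec_id : computable_sequence id.
Proof. exact: rec_proj. Qed.

Lemma rec_add n (f g : n.-tuple nat -> nat) :
  recursive f -> recursive g -> recursive (fun v => f v + g v).
Proof.
apply: rec_comp2; apply: (@rec_prim2 addn id (fun _ z _ => z.+1)) => //.
- exact: rec_id.
- apply: rec_succ1; exact: rec_proj.
Qed.

Lemma rec_mul n (f g : n.-tuple nat -> nat) :
  recursive f -> recursive g -> recursive (fun v => f v * g v).
Proof.
apply: rec_comp2; apply: (@rec_prim2 muln (fun=> 0) (fun _ z a => a + z)).
- exact: rec_const.
- by apply: rec_add; exact: rec_proj.
- by move=> a; rewrite mul0n.
- by move=> y a; rewrite mulSn.
Qed.

Lemma rec_pred n (f : n.-tuple nat -> nat) : recursive f -> recursive (fun v => (f v).-1).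
Proof.
apply: rec_comp1; apply: (@rec_prim1 predn (fun y _ => y)) => //.
exact: rec_proj.
Qed.

Lemma rec_sub n (f g : n.-tuple nat -> nat) :
  recursive f -> recursive g -> recursive (fun v => f v - g v).
Proof.
move=> rf rg; apply: (@rec_comp2 _ (fun y a => a - y) g f) => //.
apply: (@rec_prim2 _ id (fun _ z _ => z.-1)) => [||a|y a].
- exact: rec_id.
- apply: rec_pred; exact: rec_proj.
- by rewrite subn0.
- by rewrite subnS.
Qed.

Lemma rec_min n (f g : n.-tuple nat -> nat) :
  recursive f -> recursive g -> recursive (fun v => minn (f v) (g v)).
Proof.
move=> rf rg; apply: eq_recursive (rec_sub rf (rec_sub rf rg)) _ => v.
by rewrite minnE.
Qed.

Lemma rec_exp n (f g : n.-tuple nat -> nat) :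
  recursive f -> recursive g -> recursive (fun v => f v ^ g v).
Proof.
move=> rf rg; apply: (@rec_comp2 _ (fun y a => a ^ y) g f) => //.
apply: (@rec_prim2 _ (fun=> 1) (fun _ z a => a * z)) => [||a|y a] //.
- exact: rec_const.
- by apply: rec_mul; exact: rec_proj.
- by rewrite expnS.
Qed.

Lemma rec_fact n (f : n.-tuple nat -> nat) : recursive f -> recursive (fun v => (f v)`!).
Proof.
apply: rec_comp1; apply: (@rec_prim1 _ (fun y z => y.+1 * z)); last exact: factS.
by apply: rec_mul; [apply: rec_succ1|]; exact: rec_proj.
Qed.

Lemma rec_div n (f g : n.-tuple nat -> nat) :
  recursive f -> recursive g -> recursive (fun v => f v %/ g v).
Proof.
apply: rec_comp2.
(* The last factor makes the search for a zero in y succeed at once when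
   d = 0, where the quotient is 0. *)
pose F y a d := (a.+1 - y.+1 * d) * d.
have rF : recursive3 F.
  apply: rec_mul; last exact: rec_proj.
  apply: rec_sub; first by apply: rec_succ1; exact: rec_proj.
  by apply: rec_mul; [apply: rec_succ1|]; exact: rec_proj.
apply: (rec_mu rF) => [v|v y]; rewrite !(tnth_nth 0) /= !inordK //= /F;
  move: (nth 0 v 0) (nth 0 v 1) => a [|d]; rewrite ?divn0 ?muln0 //.
  by apply/eqP; rewrite muln_eq0 orbF subn_eq0 -ltn_divLR.
move=> y_lt; apply/eqP; rewrite muln_eq0 orbF subn_eq0 -ltn_divLR //; lia.
Qed.

Lemma rec_mod n (f g : n.-tuple nat -> nat) :
  recursive f -> recursive g -> recursive (fun v => f v %% g v).
Proof.
move=> rf rg; apply: eq_recursive (rec_sub rf (rec_mul (rec_div rf rg) rg)) _ => v.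
by rewrite {1}(divn_eq (f v) (g v)) addKn.
Qed.

Lemma rec_L1 n (f : n.-tuple nat -> nat) : recursive f -> recursive (fun v => L1 (f v)).
Proof.
apply: rec_comp1.
(* The first factor is 0 for i < 6 and 1 otherwise. *)
pose block_length i := (1 - (6 - i)) * (3 ^ i`! * i.+1 ^ (i`! * i)) * (i`! * i ^ i`!).
have block_lengthE i : l1 i * size (X1 i) = block_length i.
  rewrite /block_length; case: (ltnP i 6) => i6.
    by rewrite /l1 i6 mul0n (_ : 1 - (6 - i) = 0) ?mul0n //; lia.
  rewrite size_X1 // /l1 ltnNge i6 /= (_ : 1 - (6 - i) = 1) ?mul1n //; lia.
apply: (@rec_prim1 _ (fun y z => z + block_length y.+1)); last first.
  by move=> y; rewrite L1S block_lengthE.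
rewrite /recursive2; apply: rec_add; first exact: rec_proj.
have ri : recursive (fun v : 2.-tuple nat => (tnth v ord0).+1).
  apply: rec_succ1; exact: rec_proj.
have rw := rec_fact ri.
rewrite /block_length; apply: rec_mul; last by apply: rec_mul => //; apply: rec_exp.
apply: rec_mul; first by do 2 ?[apply: rec_sub => //]; exact: rec_const.
apply: rec_mul; apply: rec_exp => //; [exact: rec_const|exact: rec_succ1|exact: rec_mul].
Qed.

Lemma rec_level1 n (f : n.-tuple nat -> nat) :
  recursive f -> recursive (fun v => level1 (f v)).
Proof.
apply: rec_comp1.
have rF : recursive2 (fun y n => n - L1 y).
  by apply: rec_sub; [|apply: rec_L1]; exact: rec_proj.
apply: (rec_mu rF) => [v|v y]; rewrite !(tnth_nth 0) /= !inordK //= /thead (tnth_nth 0);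
  rewrite /level1; case: ex_minnP => j n_j min_j.
  by apply/eqP; rewrite subn_eq0.
move=> y_lt; apply/eqP; rewrite subn_eq0; apply/negP => /min_j.
by rewrite leqNgt y_lt.
Qed.

Lemma rec_E1_formula n (f : n.-tuple nat -> nat) :
  recursive f -> recursive (fun v => E1_formula (f v)).
Proof.
move=> rf; rewrite /E1_formula.
have ri := rec_level1 rf; have rw := rec_fact ri.
have rq : recursive (fun v => ((f v).-1 - L1 (level1 (f v)).-1)
    %% ((level1 (f v))`! * level1 (f v) ^ (level1 (f v))`!)).
  apply: rec_mod; last by apply: rec_mul => //; apply: rec_exp.
  by apply: rec_sub; [exact: rec_pred|apply: rec_L1; exact: rec_pred].
apply: rec_mod => //; apply: rec_div; first exact: rec_div.
by apply: rec_exp => //; apply: rec_sub; [exact: rec_pred|exact: rec_mod].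
Qed.

Lemma computable_denom Q : computable_sequence Q -> computable_sequence (denom Q).
Proof.
move=> rQ; apply: (@rec_prim1 _ (fun y z => z * Q y.+1)); last exact: denomS.
apply: rec_mul; first exact: rec_proj.
by apply: (rec_comp1 rQ); apply: rec_succ1; exact: rec_proj.
Qed.

Lemma computable_numer Q E : computable_sequence Q -> computable_sequence E ->
  computable_sequence (numer Q E).
Proof.
move=> rQ rE; apply: (@rec_prim1 _ (fun y z => z * Q y.+1 + E y.+1)) => //.
have rS : recursive (fun v : 2.-tuple nat => (tnth v ord0).+1).
  by apply: rec_succ1; exact: rec_proj.
apply: rec_add; last exact: (rec_comp1 rE rS).
by apply: rec_mul; [exact: rec_proj|exact: (rec_comp1 rQ rS)].
Qed.

End Recursive.

(** * Relative normality and computability of the image of zeta1 *)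

Lemma ratio_cvg1 (R : realType) (c1 c2 : nat -> nat) :
  (forall K, \forall n \near \oo, (K * c1 n <= K.+1 * c2 n)%N) ->
  (forall K, \forall n \near \oo, (K * c2 n <= K.+1 * c1 n)%N) ->
  (\forall n \near \oo, (0 < c2 n)%N) ->
  (c1 n)%:R / (c2 n)%:R @[n --> \oo] --> (1 : R).
Proof.
move=> le12 le21 c2_gt0; apply/cvgrPdist_le => e e_gt0.
pose K := (Num.truncn e^-1).+1.
have Ke : 1 <= e * K%:R.
  by rewrite -ler_pdivrMl // mulr1 ltW // truncnS_gt.
near=> n.
have c2n : 0 < (c2 n)%:R :> R by rewrite ltr0n; near: n.
have h12 : (K * c1 n <= K.+1 * c2 n)%N by near: n; apply: le12.
have h21 : (K * c2 n <= K.+1 * c1 n)%N by near: n; apply: le21.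
rewrite -[X in X - _](divff (lt0r_neq0 c2n)) -mulrBl normrM normfV.
rewrite [`|(c2 n)%:R|]gtr0_norm //.
rewrite ler_pdivrMr //; apply: (@le_trans _ _ (e * (K%:R * `|(c2 n)%:R - (c1 n)%:R|))).
  by rewrite mulrA ler_peMl.
rewrite ler_pM2l // -[K%:R]gtr0_norm ?ltr0n // -normrM mulrBr -!natrM ler_norml.
apply/andP; split; first by rewrite lerBrDr addrC lerBlDr -natrD ler_nat; nia.
by rewrite lerBlDr -natrD ler_nat; nia.
Unshelve. all: by end_near. Qed.

Section Image.
Local Open Scope nat_scope.

Lemma near_infty (P : nat -> Prop) n0 :
  (forall n, n0 <= n -> P n) -> \forall n \near \oo, P n.
Proof. by move=> H; exists n0 => // n /H. Qed.

Lemma pattern_iota f B p :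
  ([seq f j | j <- iota p (size B)] == B) = pattern 1 f B p.
Proof.
apply/eqP/allP => [mapE t|H].
  rewrite mem_iota add0n => /= t_lt.
  by rewrite -[X in nth 0 X t]mapE (nth_map 0) ?size_iota // nth_iota // mul1n.
apply: (@eq_from_nth _ 0); rewrite ?size_map ?size_iota // => t t_lt.
rewrite (nth_map 0) ?size_iota // nth_iota //; apply/eqP.
by have := H t; rewrite mem_iota mul1n; apply.
Qed.

(** Zeros are non-maximal digits in every base; having them in every residue class
    makes each digit sequence below the genuine expansion of its sum. *)
Lemma zeros_in_class m r N : 0 < m -> exists n, [/\ N < n, n = r %[mod m] & E1 n = 0].
Proof.
move=> m_gt0; pose o := class_pattern m r 1 E1 [:: 0].
have oP : eventually_pattern m r 1 [:: 0] o by exists 0.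
have [n0 n0P] := pattern_unbounded m_gt0 (ltn0Sn 0) N.+1 oP.
have : has o (iota N.+1 n0).
  rewrite has_count -(ltn_add2l N) addn0.
  apply: leq_trans (n0P (N + n0) (leq_addl _ _)) _.
  rewrite iotaD count_cat add1n leq_add2r.
  by apply: leq_trans (count_size _ _) _; rewrite size_iota.
case/hasP => n; rewrite mem_iota => /andP[N_lt _] /andP[/eqP nr].
by rewrite /pattern /= andbT muln0 addn0 => /eqP En; exists n.
Qed.

Lemma prog_gt0 m r j : 0 < m -> 1 <= j -> 1 <= prog m r j.
Proof. by rewrite /prog; case: eqP; case: j => [|j] //=; nia. Qed.

Lemma progD m r j t : 1 <= j -> prog m r (j + t) = prog m r j + m * t.
Proof. by rewrite /prog; case: eqP; case: j => [|j] //=; nia. Qed.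

Lemma progP m r p : r < m -> 1 <= p -> p = r %[mod m] ->
  exists2 j, 1 <= j & p = prog m r j.
Proof.
move=> r_lt p1; rewrite (modn_small r_lt) => pr; have := divn_eq p m; rewrite pr => pE.
rewrite /prog; case: eqP => r0.
  exists (p %/ m); last by rewrite {1}pE; lia.
  by move: pE; case: (p %/ m) => //; lia.
by exists (p %/ m).+1 => //=; lia.
Qed.

(** Among [m] consecutive integers exactly one lies in the class of [r], and it is
    the next term of the progression. *)
Lemma count_prog m r (P : pred nat) n : r < m ->
  count (fun j => P (prog m r j)) (iota 1 n)
  = count (fun p => (p == r %[mod m]) && P p) (iota 1 (m * n)).
Proof.
move=> r_lt; have m_gt0 : 0 < m by apply: leq_ltn_trans r_lt.
elim: n => [|n IHn]; first by rewrite muln0.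
rewrite -[n.+1]addn1 iotaD count_cat IHn mulnDr muln1 iotaD count_cat; congr (_ + _).
rewrite /= addn0 add1n count_iota.
pose d := if r == 0 then m.-1 else r.-1.
have d_lt : d < m by rewrite /d; case: eqP; lia.
rewrite (bigD1 (Ordinal d_lt)) //= big1 ?addn0 => [|[j j_lt] /= j_d].
  have -> : 1 + m * n + d = prog m r n.+1 by rewrite /d /prog; case: eqP; lia.
  rewrite (_ : _ == _ %[mod m]) //= /prog; case: (r =P 0) => [->|_].
    by rewrite modnMr mod0n.
  by rewrite addnC mulnC modnMDl.
rewrite -addnA addnCA mulnC modnMDl (modn_small r_lt) add1n.
case: eqP => //= jr; case/eqP: j_d; apply: val_inj => /=; rewrite /d.
move: jr; have := j_lt; rewrite leq_eqVlt => /orP[/eqP jm|jm].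
  by rewrite jm modnn => <- /=; lia.
by rewrite modn_small // => <-.
Qed.

Section Digits.
Variables (R : realType) (Q : nat -> nat).
Hypotheses (bQ : basic_sequence Q) (Qoo : infinite_in_limit Q).

Let F n := minn (E1 n) (Q n).-1.

Let bR1 : basic_sequence R1.
Proof. by move=> n; apply: R1_ge. Qed.

Let F_lt n : 1 <= n -> F n < Q n.
Proof. by move=> /bQ; rewrite /F; lia. Qed.

Lemma digit_zeta1 n : 1 <= n -> digit R1 (zeta1 R) n = E1 n.
Proof.
move: n; apply: digit_cantor_sum => // [n|N]; first exact: E1_lt.
have [n [N_lt _ En]] := zeros_in_class 0 N (ltn0Sn 0); exists n => //.
by rewrite En; have := bR1 (leq_ltn_trans (leq0n _) N_lt); lia.
Qed.

Lemma psi_zeta1 : psi R1 Q (zeta1 R) = cantor_sum R Q F.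
Proof. by apply: eq_cantor_sum => n n1; rewrite digit_zeta1. Qed.

Let F_zero m r N : 0 < m -> exists n, [/\ N < n, n = r %[mod m] & F n <> (Q n).-1].
Proof.
move=> /(zeros_in_class r N)[n [N_lt nr En]]; exists n; split=> //.
by rewrite /F En; have := bQ (leq_ltn_trans (leq0n _) N_lt); lia.
Qed.

Lemma digit_psi n : 1 <= n -> digit Q (psi R1 Q (zeta1 R)) n = F n.
Proof.
rewrite psi_zeta1; move: n; apply: digit_cantor_sum => // N.
by have [n [N_lt _ Fn]] := F_zero 0 N (ltn0Sn 0); exists n.
Qed.

Lemma digit_Upsilon m r j : r < m -> 1 <= j ->
  digit (Lambda m r Q) (Upsilon Q m r (psi R1 Q (zeta1 R))) j = F (prog m r j).
Proof.
move=> r_lt; have m_gt0 : 0 < m by apply: leq_ltn_trans r_lt.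
have -> : Upsilon Q m r (psi R1 Q (zeta1 R))
    = cantor_sum R (Lambda m r Q) (fun j => F (prog m r j)).
  by apply: eq_cantor_sum => i i1; rewrite digit_psi // prog_gt0.
move: j; apply: digit_cantor_sum => [i i1|i i1|N].
- by apply: bQ; rewrite prog_gt0.
- by apply: F_lt; rewrite prog_gt0.
have [n [N_lt nr Fn]] := F_zero r (prog m r N.+1) m_gt0.
have [i i1 nE] := progP r_lt (leq_ltn_trans (leq0n _) N_lt) nr.
exists i; last by rewrite /Lambda -nE.
rewrite ltnNge; apply/negP => i_le; move: N_lt; rewrite nE.
by rewrite -(subnKC (leqW i_le)) progD // ltnNge leq_addr.
Qed.

(** Truncation at [(Q n).-1] cannot create or destroy an entry that is smaller
    than [(Q n).-1]. *)
Lemma eventually_same_pattern s B : exists p0, forall p, p0 <= p ->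
  pattern s F B p = pattern s E1 B p.
Proof.
have [p0 _ Q_ge] : \forall n \near \oo, (\sum_(b <- B) b).+2 <= Q n.
  exact: (Qoo (nbhs_infty_ge _)).
exists p0 => p p_ge; apply: eq_in_all => t; rewrite mem_iota add0n => /= t_lt.
have b_le : nth 0 B t <= \sum_(b <- B) b.
  by rewrite (big_rem (nth 0 B t)) ?mem_nth //= leq_addr.
have : (\sum_(b <- B) b).+2 <= Q (p + s * t) by apply: Q_ge => /=; lia.
rewrite /F; move: (E1 _) (Q _) => e q q_ge; apply/eqP/eqP; lia.
Qed.

Lemma pattern_ratio m r s B1 B2 : 0 < m -> 0 < s -> size B1 = size B2 ->
  ((count (class_pattern m r s F B1) (iota 1 n))%:R
   / (count (class_pattern m r s F B2) (iota 1 n))%:R @[n --> \oo] --> (1 : R))%R.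
Proof.
move=> m_gt0 s_gt0 B12.
have ev B : eventually_pattern m r s B (class_pattern m r s F B).
  have [p0 same] := eventually_same_pattern s B.
  by exists p0 => p p_ge; rewrite /class_pattern same.
apply: ratio_cvg1 => [K|K|].
- have [n0 H] := frequency m_gt0 s_gt0 K B12 (ev B1) (ev B2).
  by apply: near_infty H.
- have [n0 H] := frequency m_gt0 s_gt0 K (esym B12) (ev B2) (ev B1).
  by apply: near_infty H.
- have [n0 H] := pattern_unbounded m_gt0 s_gt0 1 (ev B2).
  by apply: near_infty H.
Qed.

Lemma psi_RNI : RNI Q (psi R1 Q (zeta1 R)).
Proof.
move=> k _ m /andP[m1 _] r r_lt B1 B2 B1k B2k.
have occE B n : Nocc_mod Q m r B (psi R1 Q (zeta1 R)) n
    = count (class_pattern m r 1 F B) (iota 1 n).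
  apply: eq_in_count => p; rewrite mem_iota => /andP[p1 _].
  congr (_ && _); rewrite -pattern_iota /occurs; congr (_ == _).
  apply/eq_in_map => j; rewrite mem_iota => /andP[j_ge _].
  by rewrite digit_psi // (leq_trans p1).
under eq_fun do rewrite !occE.
by apply: pattern_ratio; rewrite // B1k.
Qed.

Lemma psi_RNII : RNII Q (psi R1 Q (zeta1 R)).
Proof.
move=> k _ m m1 r r_lt B1 B2 B1k B2k.
have occE B n : Nocc (Lambda m r Q) B (Upsilon Q m r (psi R1 Q (zeta1 R))) n
    = count (class_pattern m r m F B) (iota 1 (m * n)).
  rewrite -count_prog //; apply: eq_in_count => j; rewrite mem_iota => /andP[j1 _].
  rewrite /occurs (eq_in_map _ (fun i => F (prog m r i)) _).1; last first.
    move=> i; rewrite mem_iota => /andP[i_ge _].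
    by rewrite digit_Upsilon // (leq_trans j1).
  rewrite pattern_iota; apply: eq_all => t; by rewrite mul1n progD.
under eq_fun do rewrite !occE.
have mul_oo : (fun n => m * n) @ \oo --> \oo.
  move=> A [n0 _ H]; exists n0 => // n /= n_ge; apply: H => /=.
  by apply: leq_trans n_ge _; rewrite leq_pmull.
have H : size B1 = size B2 by rewrite B1k.
exact: (cvg_comp _ _ mul_oo (pattern_ratio r m1 m1 H)).
Qed.

Lemma computable_psi : computable_sequence Q -> computable_real (psi R1 Q (zeta1 R)).
Proof.
move=> rQ; pose F' n := minn (E1_formula n) (Q n).-1.
have rF' : computable_sequence F'.
  by apply: rec_min; [apply: rec_E1_formula rec_id|apply: rec_pred rQ].
have FF' n : 1 <= n -> F n = F' n by move=> n1; rewrite /F E1_formulaE.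
(* The tail after n terms is at most 1 / denom Q n <= 2 ^- n. *)
exists (numer Q F'), (fun=> 0), (fun n => (denom Q n).-1); split.
- exact: computable_numer.
- exact: rec_const.
- exact: rec_pred (computable_denom rQ).
move=> n; rewrite prednK ?denom_gt0 // subr0 -(eq_numer Q n FF') psi_zeta1.
have D_gt0 : (0 < (denom Q n)%:R :> R)%R by rewrite ltr0n denom_gt0.
have lo := cantor_sum_ge R bQ F_lt n; have hi := cantor_sum_le R bQ F_lt n.
rewrite ger0_norm ?subr_ge0 // lerBlDl (le_trans hi) // -natr1 mulrDl lerD2l div1r.
by rewrite lef_pV2 ?posrE // ?exprn_gt0 // -natrX ler_nat denom_ge.
Qed.

End Digits.

Lemma RNI_sub_RN (R : realType) Q : RNI (R := R) Q `<=` RN (R := R) Q.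
Proof.
move=> x xI k k1 B1 B2 B1k B2k.
have occE B n : Nocc Q B x n = Nocc_mod Q 1 0 B x n.
  by apply: eq_count => p; rewrite !modn1.
by under eq_fun do rewrite !occE; apply: (xI k k1 1 _ 0).
Qed.

End Image.

Theorem theorem1p15 (R : realType) (Q : nat -> nat) :
  basic_sequence Q -> infinite_in_limit Q ->
  [/\ (RNI (R := R) Q `&` RNII (R := R) Q) (psi R1 Q (zeta1 R)),
      RNI (R := R) Q `&` RNII (R := R) Q `<=` RN (R := R) Q
    & computable_sequence Q -> computable_real (psi R1 Q (zeta1 R))].
Proof.
move=> bQ Qoo; split; last exact: computable_psi.
  by split; [apply: psi_RNI|apply: psi_RNII].
by move=> x [xI _]; apply: RNI_sub_RN.
Qed.
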